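(* Let $$L=\sum_{j}(a_j\,\mathsf{H}+b_j)D^j\in\mathbb{R}[D,\mathsf{H}],$$ where $j$ ranges over the non-negative integers, $a_j,b_j\in\mathbb{R}$ and only finitely many coefficients are non-zero, and define $$R=\sum_{j}(a_j\,\mathsf{H}-b_j)D^j.$$ Then $LR=RL\in\mathbb{R}[D]$.
   Context: $D$ is the differentiation operator and $\mathsf{H}$ is the Hilbert transform, $\mathsf{H}f(t)=\frac1\pi\,\mathrm{p.v.}\!\int_{-\infty}^{\infty}\frac{f(s)}{t-s}\,\mathrm{d}s$ (Cauchy principal value). It satisfies $\mathsf{H}^2=-\mathrm{Id}$ and $\mathsf{H}D=D\mathsf{H}$. $\mathbb{R}[D,\mathsf{H}]$ denotes the real (commutative) algebra consisting of all finite real linear combinations of $D^k$ and $\mathsf{H}D^k$, $k=0,1,2,\dots$ ($D^0=\mathrm{Id}$), with product given by composition subject to the relations just stated; $\mathbb{R}[D]$ is its subalgebra of polynomials in $D$ with real coefficients. *)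

(* Defs.v *)
From HB Require Import structures.
From mathcomp Require Import all_boot all_order all_algebra.
From mathcomp Require Import all_classical all_reals all_analysis.

Set Implicit Arguments.
Unset Strict Implicit.
Unset Printing Implicit Defensive.

Import Order.TTheory GRing.Theory Num.Theory.
Import numFieldNormedType.Exports.

Local Open Scope classical_set_scope.
Local Open Scope ring_scope.

(* The principal value is taken both at the singularity s = t (e -> 0+) and at
   infinity (N -> +oo), the two limits being independent. *)
Definition pv_trunc (R : realType) (f : R -> R) (t : R) (eN : R * R) : R :=
  \int[lebesgue_measure]_(s in [set s : R | eN.1 <= `|t - s| <= eN.2])
    (f s / (t - s)).

Definition pv_filter (R : realType) : set_system (R * R) :=
  filter_prod (0 : R)^'+ (pinfty_nbhs R).
Arguments pv_filter R : clear implicits.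

Definition pv_exists (R : realType) (f : R -> R) (t : R) : Prop :=
  cvg (pv_trunc f t @ pv_filter R).

Definition hilbert (R : realType) (f : R -> R) : R -> R :=
  fun t => pi^-1 * lim (pv_trunc f t @ pv_filter R).

(* A space of functions on which differentiation and the Hilbert transform are
   defined and act, with the relations H^2 = -Id and HD = DH.  Stability under
   differentiation makes its elements smooth.  An example is the space of the
   smooth functions all of whose derivatives are square-integrable. *)
Record DHspace (R : realType) := MkDHspace {
  DHfun : {pred (R -> R)} ;
  DHfun_submod : GRing.submod_closed DHfun ;
  DHfun_derivable : forall f, f \in DHfun -> forall t : R, derivable f t 1 ;
  DHfun_derive : forall f, f \in DHfun -> derive1 f \in DHfun ;
  DHfun_pv : forall f, f \in DHfun -> forall t : R, pv_exists f t ;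
  DHfun_hilbert : forall f, f \in DHfun -> hilbert f \in DHfun ;
  DHfun_hilbertK : forall f, f \in DHfun -> hilbert (hilbert f) = - f ;
  DHfun_hilbert_derive : forall f, f \in DHfun ->
    hilbert (derive1 f) = derive1 (hilbert f) }.

HB.instance Definition _ (R : realType) (S : DHspace R) :=
  GRing.isSubmodClosed.Build R (R -> R) (DHfun S) (DHfun_submod S).

Record DHsub (R : realType) (S : DHspace R) : Type := MkDHsub {
  DHval :> R -> R ;
  DHvalP : DHval \in DHfun S }.

HB.instance Definition _ (R : realType) (S : DHspace R) :=
  [isSub for @DHval R S].
HB.instance Definition _ (R : realType) (S : DHspace R) :=
  [Choice of DHsub S by <:].
HB.instance Definition _ (R : realType) (S : DHspace R) :=
  [SubChoice_isSubLmodule of DHsub S by <:].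

Section Operators.
Variables (R : realType) (S : DHspace R).

(* Operators on S are elements of [DHsub S -> DHsub S], with the pointwise
   real vector space structure; their product is composition [\o], so R[D,H]
   is a set of such operators and [algD] is its subalgebra R[D]. *)

Definition Dop (f : DHsub S) : DHsub S :=
  MkDHsub (DHfun_derive (DHvalP f)).

Definition Hop (f : DHsub S) : DHsub S :=
  MkDHsub (DHfun_hilbert (DHvalP f)).

Definition Dpow (j : nat) : DHsub S -> DHsub S := iter j Dop.

Definition algD : set (DHsub S -> DHsub S) :=
  [set T | exists (n : nat) (c : nat -> R), T = \sum_(j < n) c j *: Dpow j].

End Operators.

Arguments Dop {R} S.
Arguments Hop {R} S.
Arguments Dpow {R} S.
Arguments algD {R} S.

(* Main.v *)
From HB Require Import structures.
Require Import Defs.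
From mathcomp Require Import all_boot all_order all_algebra.
From mathcomp Require Import all_classical all_reals all_analysis.

Set Implicit Arguments.
Unset Strict Implicit.
Unset Printing Implicit Defensive.

Import Order.TTheory GRing.Theory Num.Theory.
Import numFieldNormedType.Exports.

Local Open Scope classical_set_scope.
Local Open Scope ring_scope.

(** Collecting the terms with and without [H], [L = H p(D) + q(D)] and
    [L' = H p(D) - q(D)] for two real polynomials [p] and [q].  As [H] commutes
    with [D] and [H^2 = -1], it behaves like an imaginary unit, and [L] and
    [- L'] like the conjugate complex polynomials [q + i p] and [q - i p].  The
    mixed terms of [L L'] therefore cancel, and
    [L L' = L' L = - (p^2 + q^2)(D)], a polynomial in [D].  The multiplication
    rule behind this is [HpolyD_comp].

    Reordering the factors uses that [H] and [D] are linear on the function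
    space.  For [D] this is elementary calculus.  For [H], a principal value
    defined through possibly meaningless integrals, linearity has to be
    derived ([hilbert_lincomb]): an element of the space is differentiable,
    hence continuous, so each truncated integral is that of a continuous
    function over a compact set; it converges and is linear in the function,
    and the limit exists by assumption. *)

Lemma compact_annulus (R : realType) (t e N : R) :
  compact [set s : R | e <= `|t - s| <= N].
Proof.
have -> : [set s : R | e <= `|t - s| <= N] =
    `[t - N, t + N] `&` (fun s => `|t - s|) @^-1` [set x | e <= x].
  apply/seteqP; split=> s /=; rewrite in_itv /= distrC ler_distl.
    by case/andP=> -> /andP[-> ->].
  by case=> /andP[-> ->] ->.
apply: compact_closedI; first exact: segment_compact.
apply: preimage_closed; last exact: closed_ge.
move=> s _; apply: (continuous_comp (f := fun s : R => t - s)).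
  by apply: cvgB; [exact: cvg_cst | exact: cvg_id].
exact: norm_continuous.
Qed.

Lemma integrable_pv_kernel (R : realType) (f : R -> R) (t e N : R) :
  continuous f -> 0 < e ->
  lebesgue_measure.-integrable [set s : R | e <= `|t - s| <= N]
    (EFin \o (fun s => f s / (t - s))).
Proof.
move=> cf e0; apply: continuous_compact_integrable.
  exact: compact_annulus.
apply: continuous_in_subspaceT => s /set_mem /= /andP[ets _].
have ts0 : t - s != 0 by rewrite -normr_gt0 (lt_le_trans e0).
apply: cvgM; first exact: cf.
by apply: cvgV => //; apply: cvgB; [exact: cvg_cst | exact: cvg_id].
Qed.

(** The inner radius has to be positive: otherwise the kernel is singular on the
    domain, and the integrals of non-integrable functions need not add up. *)
Lemma pv_trunc_lincomb (R : realType) (f g : R -> R) (k t : R) (eN : R * R) :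
  continuous f -> continuous g -> 0 < eN.1 ->
  pv_trunc (k *: f + g) t eN = k * pv_trunc f t eN + pv_trunc g t eN.
Proof.
case: eN => e N /= cf cg e0; rewrite /pv_trunc /=.
have mA : measurable [set s : R | e <= `|t - s| <= N].
  apply: measurable_realfun.closed_measurable.
  by apply: compact_closed => //; exact: compact_annulus.
have If := integrable_pv_kernel t N cf e0.
have Ig := integrable_pv_kernel t N cg e0.
rewrite -RintegralZl // -RintegralD //.
  apply: eq_Rintegral => s _; rewrite mulrA -mulrDl //.
exact: (integrableZl _ k If).
Qed.

(** Truncated integrals are linear in the function for a positive inner radius,
    and this holds eventually along the filter of the principal value. *)
Lemma hilbert_lincomb (R : realType) (f g : R -> R) (k : R) :
  continuous f -> continuous g ->
  (forall t, pv_exists f t) -> (forall t, pv_exists g t) ->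
  hilbert (k *: f + g) = k *: hilbert f + hilbert g.
Proof.
move=> cf cg pf pg; apply/funext => t.
rewrite /hilbert.
have -> : (k *: (fun t => pi^-1 * lim (pv_trunc f t @ pv_filter R)) +
    (fun t => pi^-1 * lim (pv_trunc g t @ pv_filter R))) t =
  pi^-1 * (k * lim (pv_trunc f t @ pv_filter R)
           + lim (pv_trunc g t @ pv_filter R)).
  by rewrite mulrDr mulrCA.
congr (_ * _).
apply: cvg_lim => //.
(* It suffices to identify the truncations near the filter with the
   corresponding combination of convergent truncations. *)
apply: cvg_trans; last first.
  exact: (cvgD (cvgZl_tmp (k := k) (pf t)) (pg t)).
apply: near_eq_cvg.
exists ([set e | 0 < e], setT).
  by split; [exact: nbhs_right_gt|exact: filterT].
by move=> eN [/= e0 _]; rewrite pv_trunc_lincomb.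
Qed.

Lemma derive1_lincomb (R : realType) (f g : R -> R) (k : R) :
  (forall t, derivable f t 1) -> (forall t, derivable g t 1) ->
  derive1 (k *: f + g) = k *: derive1 f + derive1 g.
Proof.
move=> df dg; apply/funext => t; rewrite !fctE !derive1E -!fctE.
by rewrite deriveD ?deriveZ //; exact: derivableZ.
Qed.

Section OperatorAlgebra.
Variables (R : realType) (S : DHspace R).
Implicit Types (f g : DHsub S) (p q : {poly R}).

Let DHfun_continuous f : continuous (f : R -> R).
Proof.
move=> t; apply: differentiable_continuous; apply/derivable1_diffP.
by apply: DHfun_derivable; exact: DHvalP.
Qed.

Fact Dop_linear : linear (Dop S).
Proof.
move=> k f g; apply: val_inj => /=.
apply: derive1_lincomb => t; apply: DHfun_derivable; exact: DHvalP.
Qed.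

Fact Hop_linear : linear (Hop S).
Proof.
move=> k f g; apply: val_inj => /=.
by apply: hilbert_lincomb; [exact: DHfun_continuous | exact: DHfun_continuous
  | exact: DHfun_pv (DHvalP f) | exact: DHfun_pv (DHvalP g)].
Qed.

HB.instance Definition _ := GRing.isLinear.Build _ _ _ _ (Dop S) Dop_linear.
HB.instance Definition _ := GRing.isLinear.Build _ _ _ _ (Hop S) Hop_linear.

Lemma HopK f : Hop S (Hop S f) = - f.
Proof. by apply: val_inj; exact: DHfun_hilbertK (DHvalP f). Qed.

Lemma Hop_Dpow j f : Hop S (Dpow S j f) = Dpow S j (Hop S f).
Proof.
elim: j => //= j <-; apply: val_inj.
exact: DHfun_hilbert_derive (DHvalP (Dpow S j f)).
Qed.

Definition polyD p : DHsub S -> DHsub S := \sum_(i < size p) p`_i *: Dpow S i.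

(** The number of terms may exceed the size of the polynomial, which lets
    polynomials of different sizes be compared over a common index range. *)
Lemma polyDE n p f : (size p <= n)%N ->
  polyD p f = \sum_(i < n) p`_i *: Dpow S i f.
Proof.
move=> le_pn; rewrite /polyD fct_sumE.
rewrite (big_ord_widen _ (fun i => p`_i *: Dpow S i f) le_pn).
rewrite big_mkcond; apply: eq_bigr => i _; case: ltnP => // le_pi.
by rewrite nth_default // scale0r.
Qed.

Lemma polyD_poly n (c : nat -> R) f :
  polyD (\poly_(j < n) c j) f = \sum_(j < n) c j *: Dpow S j f.
Proof.
rewrite (polyDE _ (size_poly n c)); apply: eq_bigr => i _.
by rewrite coef_poly ltn_ord.
Qed.

Lemma polyDD p q f : polyD (p + q) f = polyD p f + polyD q f.
Proof.
pose n := maxn (size (p + q)%R) (maxn (size p) (size q)).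
rewrite !(@polyDE n) ?leq_max ?leqnn ?orbT // -big_split /=.
by apply: eq_bigr => i _; rewrite coefD scalerDl.
Qed.

Lemma polyDZ c p f : polyD (c *: p) f = c *: polyD p f.
Proof.
rewrite (polyDE _ (size_scale_leq c p)) (polyDE _ (leqnn _)) scaler_sumr.
by apply: eq_bigr => i _; rewrite coefZ scalerA.
Qed.

Lemma polyDN p f : polyD (- p) f = - polyD p f.
Proof. by rewrite -scaleN1r polyDZ scaleN1r. Qed.

Lemma polyDC c f : polyD c%:P f = c *: f.
Proof. by rewrite (polyDE _ (size_polyC_leq1 c)) big_ord1 coefC. Qed.

Lemma polyD0 f : polyD 0 f = 0.
Proof. by rewrite -polyC0 polyDC scale0r. Qed.

Lemma polyDMX p f : polyD (p * 'X) f = Dop S (polyD p f).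
Proof.
have le_pX : (size (p * 'X)%R <= (size p).+1)%N.
  by rewrite (leq_trans (size_polyMleq _ _)) // size_polyX addn2.
rewrite (polyDE _ le_pX) (polyDE f (leqnn _)) big_ord_recl.
rewrite coefMX scale0r add0r linear_sum; apply: eq_bigr => i _.
by rewrite linearZ coefMX.
Qed.

(** By induction on [p] in Horner form, multiplication by ['X] being [D]. *)
Lemma polyDM p q f : polyD (p * q) f = polyD p (polyD q f).
Proof.
elim/poly_ind: p => [|p c IHp]; first by rewrite mul0r !polyD0.
by rewrite mulrDl mulrAC mul_polyC !polyDD !polyDMX IHp polyDZ polyDC.
Qed.

Lemma polyD_linear p : linear (polyD p).
Proof.
move=> k f g; elim/poly_ind: p => [|p c IHp].
  by rewrite !polyD0 scaler0 addr0.
rewrite !polyDD !polyDMX !polyDC IHp linearP !scalerDr !scalerA mulrC.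
by rewrite addrACA.
Qed.

HB.instance Definition _ p :=
  GRing.isLinear.Build _ _ _ _ (polyD p) (polyD_linear p).

Lemma Hop_polyD p f : Hop S (polyD p f) = polyD p (Hop S f).
Proof.
rewrite !(polyDE _ (leqnn _)) linear_sum.
by apply: eq_bigr => i _; rewrite linearZ /= Hop_Dpow.
Qed.

Lemma algD_polyD p : algD S (polyD p).
Proof. by exists (size p), (fun i => p`_i). Qed.

Definition HpolyD p q f : DHsub S := Hop S (polyD p f) + polyD q f.

Lemma HpolyD_sum n (a b : nat -> R) :
  \sum_(j < n) ((a j *: Hop S + b j *: idfun) \o Dpow S j) =
  HpolyD (\poly_(j < n) a j) (\poly_(j < n) b j).
Proof.
apply/funext => f; rewrite /HpolyD !polyD_poly linear_sum -big_split fct_sumE.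
by apply: eq_bigr => j _; rewrite linearZ.
Qed.

(** Since [H] squares to [-1] and commutes with [p(D)], pairs [(p, q)] multiply
    like the complex polynomials [q + i p]. *)
Lemma HpolyD_comp p q p' q' :
  HpolyD p q \o HpolyD p' q' =
  HpolyD (p * q' + q * p') (q * q' - p * p').
Proof.
apply/funext => f; rewrite /HpolyD /= !linearD /= -!Hop_polyD HopK.
rewrite !polyDD polyDN !polyDM !linearD /=.
by rewrite -addrA addrC !addrA.
Qed.

End OperatorAlgebra.

Theorem theorem5p1 (R : realType) (S : DHspace R) (n : nat) (a b : nat -> R) :
  let L : DHsub S -> DHsub S :=
    \sum_(j < n) ((a j *: Hop S + b j *: idfun) \o Dpow S j) in
  let L' : DHsub S -> DHsub S :=
    \sum_(j < n) ((a j *: Hop S - b j *: idfun) \o Dpow S j) in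
  L \o L' = L' \o L /\ algD S (L \o L').
Proof.
move=> L L'; pose p := \poly_(j < n) a j; pose q := \poly_(j < n) b j.
have LE : L = HpolyD p q by exact: HpolyD_sum.
have L'E : L' = HpolyD p (- q).
  rewrite (_ : - q = \poly_(j < n) - b j).
    by rewrite -HpolyD_sum; apply: eq_bigr => j _; rewrite scaleNr.
  by apply/polyP => j; rewrite coefN !coef_poly; case: ifP; rewrite ?oppr0.
rewrite LE L'E !HpolyD_comp !mulrN !mulNr (mulrC p q) addNr subrr; split=> //.
rewrite (_ : HpolyD _ _ = polyD (- (q * q) - p * p)); first exact: algD_polyD.
by apply/funext => f; rewrite /HpolyD polyD0 linear0 add0r.
Qed.
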